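(* Let $\mathcal A$ be a deterministic streaming algorithm maintaining a signed multiset over a finite set $S$ that is uniquely represented, with associated map $u$ from signed multisets to states. If $P,Q$ are signed multisets with $u(P)=u(Q)$, then for every signed multiset $R$, $u(P+R)=u(Q+R)$.
   Context: A signed multiset over a finite set $S$ is a map $f:S\to\mathbb Z$ ($f(x)$ is the number of occurrences of $x$). Inserting $x$ increases $f(x)$ by one; deleting $x$ decreases $f(x)$ by one, so any sequence of insertions and deletions (in any order) starting from the empty multiset (all values $0$) produces a well-defined signed multiset. The signed multisets form a commutative group $M\cong\mathbb Z^{|S|}$ under pointwise addition $(f+g)(x)=f(x)+g(x)$. A deterministic streaming algorithm maintaining a signed multiset has a fixed initial state and processes insert/delete operations one at a time, each operation deterministically transforming the current state into a new state. Such an algorithm is uniquely represented if its state at any time depends only on the signed multiset produced by the operations so far, and not on the order of the insertions and deletions creating it; i.e., there is a map $u$ from $M$ to states such that after any sequence of updates producing multiset $A$ the state is $u(A)$. *)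

(* Defs.v *)
From mathcomp Require Import all_boot all_order all_algebra.

Set Implicit Arguments.
Unset Strict Implicit.
Unset Printing Implicit Defensive.

Import GRing.Theory.
Local Open Scope ring_scope.

(* A notation, so that + and 0 are the pointwise zmodType operations on finite
   functions; 0 is the empty multiset. *)
Notation signed_multiset S := {ffun S -> int}.

Inductive update (S : Type) : Type :=
  | Insert of S
  | Delete of S.

Definition apply_update (S : finType) (f : signed_multiset S) (o : update S) :
    signed_multiset S :=
  match o with
  | Insert x => [ffun y => if y == x then f y + 1 else f y]
  | Delete x => [ffun y => if y == x then f y - 1 else f y]
  end.

Definition produced (S : finType) (os : seq (update S)) : signed_multiset S :=
  foldl (@apply_update S) 0 os.

Record streaming_algorithm (S : finType) : Type := StreamingAlgorithm {
  state : Type;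
  init_state : state;
  step : state -> update S -> state
}.

Definition run (S : finType) (A : streaming_algorithm S)
    (os : seq (update S)) : state A :=
  foldl (@step S A) (init_state A) os.

Definition uniquely_represented_by (S : finType) (A : streaming_algorithm S)
    (u : signed_multiset S -> state A) : Prop :=
  forall os : seq (update S), run A os = u (produced os).

(* Main.v *)
Require Import Defs.
From mathcomp Require Import all_boot all_order all_algebra.

Import GRing.Theory.

Local Open Scope ring_scope.

(** Updates act on signed multisets by translation, and every signed multiset
    is produced by some sequence of updates. If [p], [q] and [r] produce [P],
    [Q] and [R], then the runs on [p ++ r] and [q ++ r] agree after [p] and
    after [q], hence also after [r], and they end in [u (P + R)] and
    [u (Q + R)]. *)

Lemma apply_updateD (S : finType) (f g : signed_multiset S) (o : update S) :
  apply_update (f + g) o = f + apply_update g o.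
Proof.
by case: o => x; apply/ffunP => y; rewrite !ffunE; case: ifP; rewrite ?addrA.
Qed.

Lemma produced_cat (S : finType) (os1 os2 : seq (update S)) :
  produced (os1 ++ os2) = produced os1 + produced os2.
Proof.
(* Induction from the right: [foldl] applies the last update outermost, where [apply_updateD] pulls
   the summand [produced os1] out of it. *)
elim/last_ind: os2 => [|os2 o IH]; first by rewrite cats0 addr0.
by rewrite -rcons_cat /produced !foldl_rcons -!/(produced _) IH apply_updateD.
Qed.

Lemma produced_nseq_Insert (S : finType) (x : S) (n : nat) :
  produced (nseq n (Insert x)) = [ffun y => if y == x then n%:Z else 0].
Proof.
elim: n => [|n IH]; first by apply/ffunP => y; rewrite !ffunE if_same.
rewrite -[n.+1]addn1 nseqD produced_cat IH; apply/ffunP => y; rewrite !ffunE.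
by case: (y == x); rewrite ?PoszD ?add0r.
Qed.

Lemma produced_nseq_Delete (S : finType) (x : S) (n : nat) :
  produced (nseq n (Delete x)) = [ffun y => if y == x then - n%:Z else 0].
Proof.
elim: n => [|n IH]; first by apply/ffunP => y; rewrite !ffunE if_same.
rewrite -[n.+1]addn1 nseqD produced_cat IH; apply/ffunP => y; rewrite !ffunE.
by case: (y == x); rewrite ?PoszD ?opprD ?add0r.
Qed.

(** A finite sum of multisets supported at single points gives [f]; each summand comes from
    repeating one update, and concatenation realizes sums. *)
Lemma produced_surj (S : finType) (f : signed_multiset S) :
  exists os, produced os = f.
Proof.
have -> : f = \sum_x [ffun y => if y == x then f x else 0].
  apply/ffunP => y; rewrite sum_ffunE (bigD1 y) //= ffunE eqxx big1 ?addr0 //.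
  by move=> x; rewrite ffunE eq_sym => /negPf->.
apply: (big_ind (fun g => exists os, produced os = g)).
- by exists [::].
- by move=> _ _ [os1 <-] [os2 <-]; exists (os1 ++ os2); rewrite produced_cat.
move=> x _; case: (f x) => n.
  by exists (nseq n (Insert x)); rewrite produced_nseq_Insert.
(* [Negz n] stands for [-(n+1)], hence [n.+1] deletions. *)
by exists (nseq n.+1 (Delete x)); rewrite produced_nseq_Delete NegzE.
Qed.

Theorem lemma1 (S : finType) (A : streaming_algorithm S)
    (u : signed_multiset S -> state A)
    (hu : uniquely_represented_by u)
    (P Q : signed_multiset S) (hPQ : u P = u Q)
    (R : signed_multiset S) :
  u (P + R) = u (Q + R).
Proof.
case: (produced_surj _ P) (produced_surj _ Q) (produced_surj _ R) hPQ.
(* With [hPQ] still in the goal, [hu] read backwards also turns it into [run A p = run A q]. *)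
move=> p <- [q <-] [r <-]; rewrite -!produced_cat -!hu => eq_pq.
by rewrite /run !foldl_cat -!/(run A _) eq_pq.
Qed.
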